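(* For every real $\alpha>1$ there is a constant $K_\alpha$ depending only on $\alpha$ such that the online greedy speed scaling algorithm is $K_\alpha$-competitive for every fractional sum scheduling objective: for every instance, if $\widetilde z$ is the schedule produced by the algorithm, then $$\beta\sum_t\Big(\sum_j p_j\widetilde z_{jt}\Big)^\alpha+\sum_j\sum_t C_{jt}\widetilde z_{jt}\;\le\;K_\alpha\cdot\min_{z}\ \Big(\beta\sum_t\Big(\sum_j p_j z_{jt}\Big)^\alpha+\sum_j\sum_t C_{jt}z_{jt}\Big),$$ where the minimum is over all $z=(z_{jt})$ with $z_{jt}\ge0$ and $\sum_t z_{jt}\ge1$ for every job $j$.
   Context: Speed scaling with a sum scheduling objective: time is a finite set of unit time slots $t$. Jobs $j=1,\dots,n$ arrive one by one in order of release time; job $j$ has release time $r_j$, work $p_j>0$, and scheduling costs $C_{jt}\in[0,\infty]$, where $C_{jt}=\infty$ for $t<r_j$ and $C_{jt}<\infty$ for at least one $t$ (convention $0\cdot\infty=0$). A single processor can run at any nonnegative speed $s$ and uses power $s^\alpha$. The variable $z_{jt}$ is the fraction of job $j$'s work done in slot $t$, so $x_{jt}=p_jz_{jt}$ is the amount of work of $j$ done in slot $t$ and $\sum_j x_{jt}$ is the speed in slot $t$. The fractional scheduling objective is $\mathcal S=\sum_j\sum_t\frac{x_{jt}}{p_j}C_{jt}$, the energy is $\mathcal E=\sum_t\big(\sum_j x_{jt}\big)^\alpha$, and the total cost is $\mathcal S+\beta\mathcal E$ with $\beta>0$ a given constant. All data of job $j$ become known when $j$ is released. Online greedy speed scaling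 algorithm: put $\delta=1/\alpha^{\alpha-1}$. When job $j$ is released, its whole schedule $(z_{jt})_t$ is fixed greedily, by continuously increasing $z_{jt}$ in slots $t$ that currently minimize $\delta\,\alpha\,\beta\,p_j\big(\sum_{i\le j}p_iz_{it}\big)^{\alpha-1}p_{j}^{0}+C_{jt}$ (the factor $p_j^0=1$), until $\sum_t z_{jt}=1$. Formally, given $z_{it}$ for $i<j$, $(z_{jt})_t$ are the unique nonnegative numbers summing to $1$ such that whenever $z_{jt}>0$, one has for every slot $t'$ $$\delta\,\alpha\,\beta\,p_j\Big(\sum_{i\le j}p_iz_{it}\Big)^{\alpha-1}+C_{jt}\le\delta\,\alpha\,\beta\,p_j\Big(\sum_{i\le j}p_iz_{it'}\Big)^{\alpha-1}+C_{jt'}.$$ *)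

(* Defs.v *)
From HB Require Import structures.
From mathcomp Require Import all_boot all_order all_algebra.
From mathcomp Require Import all_classical all_reals all_analysis.

Set Implicit Arguments.
Unset Strict Implicit.
Unset Printing Implicit Defensive.

Import Order.TTheory GRing.Theory Num.Theory.

Local Open Scope ring_scope.

(* Jobs and unit time slots are indexed from 0. A job that cannot be run in a
   slot has cost +oo there; in \bar R the convention 0 * +oo = 0 holds. *)
Record instance (R : realType) := Instance {
  njobs : nat;
  nslots : nat;
  beta : R;
  release : 'I_njobs -> nat;
  work : 'I_njobs -> R;
  scost : 'I_njobs -> 'I_nslots -> \bar R;
  beta_gt0 : 0 < beta;
  release_sorted : forall i j : 'I_njobs, (i <= j)%N ->
    (release i <= release j)%N;
  work_gt0 : forall j, 0 < work j;
  scost_ge0 : forall j t, (0 <= scost j t)%E;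
  scost_unreleased : forall (j : 'I_njobs) (t : 'I_nslots),
    (t < release j)%N -> scost j t = +oo%E;
  scost_fin : forall j, exists t, (scost j t < +oo)%E
}.

(* z j t is the fraction of the work of job j done in slot t. *)
Definition schedule (R : realType) (I : instance R) :=
  'I_(njobs I) -> 'I_(nslots I) -> R.

Definition feasible (R : realType) (I : instance R) (z : schedule I) : Prop :=
  (forall j t, 0 <= z j t) /\ (forall j, 1 <= \sum_t z j t).

Definition energy (R : realType) (alpha : R) (I : instance R)
    (z : schedule I) : R :=
  \sum_t (\sum_j work j * z j t) `^ alpha.

Definition scheduling_cost (R : realType) (I : instance R)
    (z : schedule I) : \bar R :=
  (\sum_j \sum_t scost j t * (z j t)%:E)%E.

Definition total_cost (R : realType) (alpha : R) (I : instance R)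
    (z : schedule I) : \bar R :=
  ((beta I * energy alpha z)%:E + scheduling_cost z)%E.

Definition optimal (R : realType) (alpha : R) (I : instance R)
    (z : schedule I) : Prop :=
  feasible z /\
  forall z' : schedule I, feasible z' ->
    (total_cost alpha z <= total_cost alpha z')%E.

Definition delta (R : realType) (alpha : R) : R :=
  (alpha `^ (alpha - 1))^-1.

(* The quantity that job j equalizes: only the jobs released up to j count. *)
Definition marginal_cost (R : realType) (alpha : R) (I : instance R)
    (z : schedule I) (j : 'I_(njobs I)) (t : 'I_(nslots I)) : \bar R :=
  ((delta alpha * alpha * beta I * work j *
    (\sum_(i < njobs I | (i <= j)%N) work i * z i t) `^ (alpha - 1))%:E
   + scost j t)%E.

(* The conditions on row j involve only the rows i <= j, and they determine
   row j from the rows i < j, so z is the output of the online algorithm. *)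
Definition greedy_schedule (R : realType) (alpha : R) (I : instance R)
    (z : schedule I) : Prop :=
  forall j, [/\ forall t, 0 <= z j t,
                \sum_t z j t = 1 &
                forall t, 0 < z j t -> forall t',
                  (marginal_cost alpha z j t <= marginal_cost alpha z j t')%E].

(* Main.v *)
Require Import Defs.
From HB Require Import structures.
From mathcomp Require Import all_boot all_order all_algebra.
From mathcomp Require Import all_classical all_reals all_analysis.
From mathcomp Require Import ring lra.

Set Implicit Arguments.
Unset Strict Implicit.
Unset Printing Implicit Defensive.

Import Order.TTheory GRing.Theory Num.Theory.
Import numFieldNormedType.Exports.

Local Open Scope classical_set_scope.
Local Open Scope ring_scope.

(* Put lambda_j = min_t (marginal cost of job j in slot t). The greedy schedule
   spends exactly lambda_j per unit of job j, any feasible schedule z at least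
   lambda_j, so, writing y_t and x_t for the total loads of the greedy schedule
   and of z in slot t (the greedy load only grows over time),
     sum_j lambda_j <= delta alpha beta sum_t y_t^(alpha-1) x_t + S(z).
   By convexity the left-hand side is at least delta beta sum_t y_t^alpha +
   S(greedy). Young's inequality
     alpha y^(alpha-1) x <= (alpha-1)/alpha y^alpha + alpha^(alpha-1) x^alpha
   and delta = alpha^(1-alpha) turn this into
     delta/alpha beta E(greedy) + S(greedy) <= beta E(z) + S(z),
   hence K = alpha/delta = alpha^alpha. The minimum is attained because
   shrinking every row of z to sum 1 does not increase the cost, which leaves a
   compact product of simplices, on which the cost is continuous once the
   entries with infinite scheduling cost are set to 0. *)

(** * Inequalities and continuity for real powers *)

(** Young's inequality for the conjugate exponents [alpha / (alpha - 1)] and [alpha], applied to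
    [a^(alpha-1)] and [b] and multiplied by [alpha]. *)
Lemma powR_young (R : realType) (alpha a b : R) : 1 < alpha -> 0 <= a -> 0 <= b ->
  alpha * a `^ (alpha - 1) * b <= (alpha - 1) * a `^ alpha + b `^ alpha.
Proof.
move=> al1 a0 b0; have al0 : 0 < alpha by lra.
have alB0 : 0 < alpha - 1 by lra.
have pq : (alpha / (alpha - 1))^-1 + alpha^-1 = 1 by field; rewrite !gt_eqF.
have := conjugate_powR (powR_ge0 a (alpha - 1)) b0 (divr_gt0 al0 alB0) al0 pq.
rewrite -powRrM mulrC mulrCA divff ?gt_eqF// mulr1 => h.
rewrite -mulrA (mulrC (_ `^ _) b) -ler_pdivlMl//; apply: le_trans h _.
by rewrite le_eqVlt; apply/orP; left; apply/eqP; field; rewrite !gt_eqF.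
Qed.

(** Convexity at [a]: Young's inequality after substituting [a * a^(alpha-1) = a^alpha]. *)
Lemma powR_tangent (R : realType) (alpha a b : R) : 1 < alpha -> 0 <= a -> 0 <= b ->
  a `^ alpha - b `^ alpha <= alpha * a `^ (alpha - 1) * (a - b).
Proof.
move=> al1 a0 b0; have al0 : 0 < alpha by lra.
have := powR_young al1 a0 b0.
have := mulr_powRB1 a0 al0; nra.
Qed.

Lemma continuous_powR_norm (R : realType) (alpha : R) : 1 < alpha ->
  continuous (fun x : R => `|x| `^ alpha).
Proof.
move=> al1 x; have al0 : 0 < alpha by lra.
(* [M] bounds the slope on [[0, |x| + 1]]. The tangent inequality with [|x|] and [|y|] in both
   orders then gives a local Lipschitz bound, and squeezing finishes. *)
set M := alpha * (`|x| + 1) `^ (alpha - 1).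
have bound (a b : R) : 0 <= a <= `|x| + 1 -> 0 <= b ->
    a `^ alpha - b `^ alpha <= M * `|a - b|.
  move=> /andP[a0 aM] b0; apply: le_trans (powR_tangent al1 a0 b0) _.
  apply: le_trans (ler_wpM2l _ (ler_norm (a - b))) _.
    by rewrite mulr_ge0 ?powR_ge0 ?ltW.
  rewrite ler_wpM2r// ler_wpM2l ?(ltW al0)//.
  by apply: ge0_ler_powR; rewrite ?nnegrE//; lra.
have cvgN : `|y| @[y --> x] --> `|x| by exact: cvg_norm.
have cvgd : M * `| `|y| - `|x| | @[y --> x] --> 0.
  rewrite -[X in _ --> X](mulr0 M) -[in X in _ --> X](normr0 R) -(subrr `|x|).
  apply: (cvgM (cvg_cst M)).
  by apply: cvg_norm; apply: cvgB => //; exact: cvg_cst.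
apply: (@squeeze_cvgr _ _ _ _ (fun y => `|x| `^ alpha - M * `| `|y| - `|x| |)
                   (fun y => `|x| `^ alpha + M * `| `|y| - `|x| |)).
- near=> y.
  have yx : `|y| <= `|x| + 1.
    apply: ltW; near: y; apply: (cvgr_lt _ cvgN); lra.
  have h1 := @bound `|x| `|y|; have h2 := @bound `|y| `|x|.
  rewrite distrC in h1.
  have := h1 _ (normr_ge0 _); have := h2 _ (normr_ge0 _).
  rewrite !normr_ge0 yx lerDl ler01 => /(_ erefl) ? /(_ erefl) ?; lra.
- rewrite -[X in _ --> X]subr0; apply: cvgB => //; exact: cvg_cst.
- rewrite -[X in _ --> X]addr0; apply: cvgD => //; exact: cvg_cst.
Unshelve. all: by end_near.
Qed.

(** * Loads and schedules of finite cost *)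

Definition slot_load (R : realType) (I : instance R) (z : schedule I)
    (t : 'I_(nslots I)) : R :=
  \sum_j work j * z j t.

(** [fine] turns [+oo] into 0, so this real number stands for the scheduling cost of supported
    schedules. *)
Definition finite_scost (R : realType) (I : instance R) (z : schedule I) : R :=
  \sum_j \sum_t fine (scost j t) * z j t.

Definition supported (R : realType) (I : instance R) (z : schedule I) : Prop :=
  forall j t, scost j t = +oo%E -> z j t = 0.

Lemma fine_scost_ge0 (R : realType) (I : instance R)
    (j : 'I_(njobs I)) (t : 'I_(nslots I)) : 0 <= fine (scost j t).
Proof. exact/fine_ge0/scost_ge0. Qed.

Lemma slot_load_ge0 (R : realType) (I : instance R) (z : schedule I) t :
  (forall j t, 0 <= z j t) -> 0 <= slot_load z t.
Proof. by move=> z0; apply: sumr_ge0 => j _; rewrite mulr_ge0// ltW// work_gt0. Qed.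

Lemma scostM_EFin (R : realType) (I : instance R) (z : schedule I) j t :
  supported z ->
  (scost j t * (z j t)%:E = (fine (scost j t) * z j t)%:E)%E.
Proof.
move=> /(_ j t); have := scost_ge0 j t.
by case: (scost j t) => //= _ /(_ erefl) ->; rewrite mule0 mulr0.
Qed.

Lemma total_cost_supported (R : realType) (alpha : R) (I : instance R)
    (z : schedule I) : supported z ->
  total_cost alpha z = (beta I * energy alpha z + finite_scost z)%:E.
Proof.
move=> zs; rewrite /total_cost EFinD; congr (_ + _)%E.
rewrite /scheduling_cost /finite_scost -sumEFin; apply: eq_bigr => j _.
by rewrite -sumEFin; apply: eq_bigr => t _; exact: scostM_EFin.
Qed.

Lemma total_cost_unsupported (R : realType) (alpha : R) (I : instance R)
    (z : schedule I) : (forall j t, 0 <= z j t) -> ~ supported z ->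
  total_cost alpha z = +oo%E.
Proof.
move=> z0 /existsNP[j /existsNP[t /not_implyP[jt /eqP zjt]]].
have C0 i u : (0 <= scost i u * (z i u)%:E)%E.
  by rewrite mule_ge0 ?scost_ge0 ?lee_fin.
rewrite /total_cost /scheduling_cost (bigD1 j)//= (bigD1 t)//= jt.
rewrite gt0_mulye ?lte_fin ?lt0r ?zjt ?z0//.
rewrite !addye ?addey// gt_eqF// (@lt_le_trans _ _ 0%E)//;
  by do ?[apply: sume_ge0 => ? _].
Qed.

(** Using a slot of infinite cost would, by minimality, make the marginal cost infinite in every
    slot, contradicting [scost_fin]. *)
Lemma greedy_supported (R : realType) (alpha : R) (I : instance R)
    (z : schedule I) : greedy_schedule alpha z -> supported z.
Proof.
move=> zg j t jt; have [z0 _ zmin] := zg j.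
apply/eqP; rewrite eq_le z0 andbT leNgt; apply/negP => /zmin h.
have [u ju] := scost_fin j; have := h u.
rewrite /marginal_cost jt addey// leye_eq => /eqP.
by move: ju (scost_ge0 j u); case: (scost j u).
Qed.

(** * Marginal costs and the competitive bound *)

Definition prefix_load (R : realType) (I : instance R) (z : schedule I)
    (j : 'I_(njobs I)) (t : 'I_(nslots I)) : R :=
  \sum_(i < njobs I | (i <= j)%N) work i * z i t.

Definition finite_marginal (R : realType) (alpha : R) (I : instance R)
    (z : schedule I) (j : 'I_(njobs I)) (t : 'I_(nslots I)) : R :=
  delta alpha * alpha * beta I * work j * prefix_load z j t `^ (alpha - 1)
  + fine (scost j t).

Lemma prefix_load_le (R : realType) (I : instance R) (z : schedule I) j t :
  (forall j t, 0 <= z j t) -> 0 <= prefix_load z j t <= slot_load z t.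
Proof.
move=> z0; have w0 i : 0 <= work i * z i t by rewrite mulr_ge0// ltW// work_gt0.
apply/andP; split; first exact: sumr_ge0.
by rewrite /slot_load (bigID (fun i : 'I__ => (i <= j)%N))/= lerDl sumr_ge0.
Qed.

(* Telescoping the tangent inequality over the arrivals of the jobs. *)
Lemma powR_sum_le (R : realType) (alpha : R) n (x : 'I_n -> R) : 1 < alpha ->
  (forall i, 0 <= x i) ->
  (\sum_i x i) `^ alpha <=
    \sum_(j < n) alpha * (\sum_(i < n | (i <= j)%N) x i) `^ (alpha - 1) * x j.
Proof.
move=> al1; elim: n x => [|n IHn] x x0.
  by rewrite !big_ord0 powR0// gt_eqF//; lra.
rewrite [leRHS]big_ord_recr/=.
have eqS : \sum_(i < n.+1 | (i <= n)%N) x i = \sum_i x i.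
  by apply: eq_bigl => i; rewrite -ltnS ltn_ord.
have eqW : \sum_(j < n) alpha *
    (\sum_(i < n.+1 | (i <= widen_ord (leqnSn n) j)%N) x i) `^ (alpha - 1) *
    x (widen_ord (leqnSn n) j) =
    \sum_(j < n) alpha * (\sum_(i < n | (i <= j)%N)
      x (widen_ord (leqnSn n) i)) `^ (alpha - 1) * x (widen_ord (leqnSn n) j).
  apply: eq_bigr => j _; congr (_ * _ `^ _ * _).
  rewrite big_mkcond/= big_ord_recr/= leqNgt ltn_ord/= addr0 -big_mkcond.
  exact: eq_bigl.
rewrite eqS eqW; have := IHn (fun i => x (widen_ord (leqnSn n) i)) (fun=> x0 _).
set S := \sum_(i < n) x (widen_ord _ _) => IH.
have S0 : 0 <= S by exact: sumr_ge0.
have S1 : \sum_i x i = S + x ord_max by rewrite big_ord_recr.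
have T0 : 0 <= \sum_i x i by exact: sumr_ge0.
have := powR_tangent al1 T0 S0.
rewrite {3}S1 (addrC S) addrK => h; move: IH h.
by set A := S `^ _; set B := \sum_(j < n) _; set C := _ * _ * _; lra.
Qed.

Lemma marginal_cost_EFin (R : realType) (alpha : R) (I : instance R)
    (z : schedule I) j t : scost j t != +oo%E ->
  marginal_cost alpha z j t = (finite_marginal alpha z j t)%:E.
Proof.
rewrite /marginal_cost /finite_marginal EFinD.
by have := scost_ge0 j t; case: (scost j t).
Qed.

Lemma delta_gt0 (R : realType) (alpha : R) : 1 < alpha -> 0 < delta alpha.
Proof. by move=> al1; rewrite invr_gt0 powR_gt0//; lra. Qed.

Lemma finite_marginal_ge0 (R : realType) (alpha : R) (I : instance R)
    (z : schedule I) j t : 1 < alpha -> 0 <= finite_marginal alpha z j t.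
Proof.
move=> al1; rewrite addr_ge0 ?fine_scost_ge0// mulr_ge0 ?powR_ge0//.
have := delta_gt0 al1; have := beta_gt0 I; have := work_gt0 j => *.
by rewrite !mulr_ge0//; lra.
Qed.

Lemma greedy_marginal_le (R : realType) (alpha : R) (I : instance R)
    (zg z : schedule I) j : 1 < alpha ->
  greedy_schedule alpha zg -> feasible z -> supported z ->
  \sum_t zg j t * finite_marginal alpha zg j t <=
    \sum_t z j t * finite_marginal alpha zg j t.
Proof.
move=> al1 gr [z0 z1] zs; have zgs := greedy_supported gr.
have [zg0 zg1 zgmin] := gr j.
have [t0 t0P] : exists t, 0 < zg j t.
  apply/not_existsP => zg_le0; have := @ltr01 R; rewrite -zg1 big1 ?ltxx// => t _.
  by apply/eqP; rewrite eq_le zg0 andbT leNgt; apply/negP/zg_le0.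
have fin t : 0 < zg j t -> scost j t != +oo%E.
  by move=> h; apply/eqP => /zgs zgt; rewrite zgt ltxx in h.
(* The value at [t0] is lambda_j: every slot used by the greedy row attains this minimum. *)
apply: (@le_trans _ _ (finite_marginal alpha zg j t0)).
  rewrite -[leRHS]mul1r -zg1 mulr_suml ler_sum// => t _.
  have [zgt|] := ltP 0 (zg j t).
    rewrite ler_pM2l// -lee_fin -!marginal_cost_EFin ?fin//; exact: zgmin.
  move=> zgt; suff -> : zg j t = 0 by rewrite !mul0r.
  by apply/eqP; rewrite eq_le zgt zg0.
apply: (@le_trans _ _ (\sum_t z j t * finite_marginal alpha zg j t0)).
  by rewrite -mulr_suml ler_peMl// finite_marginal_ge0.
(* Where the cost is infinite, [finite_marginal] may drop below lambda_j, but there [z j t = 0]. *)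
apply: ler_sum => t _; have [/zs->|/eqP jt] := pselect (scost j t = +oo%E).
  by rewrite !mul0r.
rewrite ler_wpM2l// -lee_fin -(marginal_cost_EFin _ _ (fin _ t0P)).
by rewrite -(marginal_cost_EFin _ _ jt) zgmin.
Qed.

(** Grouping the energy terms by slot prepares the per-slot estimates; it is used for both the
    greedy schedule and its competitor. *)
Lemma sum_finite_marginal (R : realType) (alpha : R) (I : instance R)
    (zg z : schedule I) :
  \sum_j \sum_t z j t * finite_marginal alpha zg j t =
    delta alpha * beta I * \sum_t \sum_j
      alpha * prefix_load zg j t `^ (alpha - 1) * (work j * z j t)
    + finite_scost z.
Proof.
rewrite [X in _ * X]exchange_big/= mulr_sumr /finite_scost -big_split/=.
apply: eq_bigr => j _; rewrite mulr_sumr -big_split/=; apply: eq_bigr => t _.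
rewrite /finite_marginal; ring.
Qed.

Lemma greedy_competitive (R : realType) (alpha : R) (I : instance R)
    (zg z : schedule I) : 1 < alpha ->
  greedy_schedule alpha zg -> feasible z -> supported z ->
  beta I * energy alpha zg + finite_scost zg <=
    alpha `^ alpha * (beta I * energy alpha z + finite_scost z).
Proof.
move=> al1 gr zf zs; have al0 : 0 < alpha by lra.
have zg0 j t : 0 <= zg j t by case: (gr j).
have z0 j t : 0 <= z j t by case: zf.
have w0 (y : schedule I) (y0 : forall j t, 0 <= y j t) j t :
  0 <= work j * y j t by rewrite mulr_ge0// ltW// work_gt0.
have dl0 := delta_gt0 al1; have be0 := beta_gt0 I.
have main : \sum_j \sum_t zg j t * finite_marginal alpha zg j t <=
    \sum_j \sum_t z j t * finite_marginal alpha zg j t.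
  by apply: ler_sum => j _; exact: greedy_marginal_le.
rewrite !sum_finite_marginal in main.
have lower : energy alpha zg <= \sum_t \sum_j
    alpha * prefix_load zg j t `^ (alpha - 1) * (work j * zg j t).
  apply: ler_sum => t _.
  exact: (powR_sum_le al1 (fun j => w0 zg zg0 j t)).
have upper : \sum_t \sum_j
    alpha * prefix_load zg j t `^ (alpha - 1) * (work j * z j t) <=
    (alpha - 1) / alpha * energy alpha zg + alpha `^ (alpha - 1) * energy alpha z.
  rewrite /energy !mulr_sumr -big_split/= ler_sum// => t _.
  (* Prefix loads are raised to the final greedy load, as [alpha - 1 > 0]. *)
  apply: (@le_trans _ _
    (alpha * slot_load zg t `^ (alpha - 1) * slot_load z t)).
    rewrite mulr_sumr ler_sum// => j _; rewrite ler_wpM2r ?w0// ler_wpM2l ?(ltW al0)//.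
    have /andP[p0 pl] := prefix_load_le j t zg0.
    apply: ge0_ler_powR => //; rewrite ?nnegrE ?slot_load_ge0//; lra.
  (* Young with [b = alpha * slot_load z t]; dividing by [alpha] leaves the factor [alpha^(alpha-1)]
     that [delta] cancels. *)
  have := powR_young al1 (slot_load_ge0 t zg0)
    (mulr_ge0 (ltW al0) (slot_load_ge0 t z0)).
  rewrite powRM ?slot_load_ge0 ?(ltW al0)//.
  rewrite -(mulr_powRB1 (ltW al0) al0) -/(slot_load zg t) -/(slot_load z t).
  move=> h; rewrite -(ler_pM2l al0); apply: le_trans (le_trans h _).
    by rewrite le_eqVlt; apply/orP; left; apply/eqP; ring.
  by rewrite le_eqVlt; apply/orP; left; apply/eqP; field; rewrite gt_eqF.
have E0 : 0 <= energy alpha zg by rewrite sumr_ge0// => t _; exact: powR_ge0.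
have S0 : 0 <= finite_scost zg.
  by rewrite !sumr_ge0// => j _; rewrite sumr_ge0// => t _;
    rewrite mulr_ge0 ?fine_scost_ge0.
have aa1 : 1 <= alpha `^ alpha.
  by rewrite (le_trans (ltW al1))// le1r_powR ?(ltW al1).
have pa0 : 0 < alpha `^ (alpha - 1) by exact: powR_gt0.
have aE : alpha `^ alpha = alpha * alpha `^ (alpha - 1).
  by rewrite mulr_powRB1// ltW.
have db0 : 0 <= delta alpha * beta I by rewrite mulr_ge0 ?ltW.
have {}lower := ler_wpM2l db0 lower.
have {}upper := ler_wpM2l db0 upper.
have h : delta alpha * beta I / alpha * energy alpha zg + finite_scost zg <=
    beta I * energy alpha z + finite_scost z.
  suff : delta alpha * beta I * ((alpha - 1) / alpha * energy alpha zg +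
      alpha `^ (alpha - 1) * energy alpha z) =
      delta alpha * beta I * energy alpha zg
      - delta alpha * beta I / alpha * energy alpha zg
      + beta I * energy alpha z by lra.
  by rewrite /delta; field; rewrite !gt_eqF.
(* Since [alpha^alpha = alpha / delta], the energy coefficient becomes exactly [beta], while the
   scheduling cost only grows because [alpha^alpha >= 1]. *)
apply: le_trans (ler_wpM2l _ h); last by rewrite (le_trans ler01).
rewrite mulrDr lerD//; last by rewrite ler_peMl.
rewrite le_eqVlt; apply/orP; left; apply/eqP.
by rewrite aE /delta; field; rewrite !gt_eqF.
Qed.

(** * Existence of an optimal schedule *)

Lemma finite_cost_le (R : realType) (alpha : R) (I : instance R)
    (y z : schedule I) : 1 < alpha -> (forall j t, 0 <= y j t <= z j t) ->
  beta I * energy alpha y + finite_scost y <=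
    beta I * energy alpha z + finite_scost z.
Proof.
move=> al1 yz; have y0 j t : 0 <= y j t by case/andP: (yz j t).
have z0 j t : 0 <= z j t by case/andP: (yz j t) => /le_trans; apply.
have {}yz j t : y j t <= z j t by case/andP: (yz j t).
apply: lerD; last first.
  by apply: ler_sum => j _; apply: ler_sum => t _;
    rewrite ler_wpM2l// fine_scost_ge0.
rewrite (ler_pM2l (beta_gt0 I)); apply: ler_sum => t _.
apply: ge0_ler_powR; rewrite ?nnegrE ?slot_load_ge0//; first lra.
by apply: ler_sum => j _; rewrite (ler_pM2l (work_gt0 j)).
Qed.

Lemma continuous_sumr (R : realType) (T : topologicalType) (n : nat)
    (f : 'I_n -> T -> R) : (forall i, continuous (f i)) ->
  continuous (fun x => \sum_i f i x).
Proof.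
move=> fc x; apply: cvg_big => [|i _]; last exact: fc.
exact: add_continuous.
Qed.

Lemma optimal_exists (R : realType) (alpha : R) (I : instance R)
    (z0 : schedule I) : 1 < alpha -> (forall j t, 0 <= z0 j t) ->
  (forall j, \sum_t z0 j t = 1) -> supported z0 ->
  exists z : schedule I, optimal alpha z /\ supported z.
Proof.
move=> al1 z00 z01 z0s; have be0 := beta_gt0 I.
pose idx := ('I_(njobs I) * 'I_(nslots I))%type.
(* Schedules are uncurried into a product space so that Tychonoff's theorem applies; the singleton
   boxes below encode [supported]. *)
pose T := prod_topology (fun _ : idx => R).
pose box (p : idx) : set R :=
  if scost p.1 p.2 == +oo%E then [set 0] else `[0, 1]%classic.
pose sched (f : T) : schedule I := fun j t => f (j, t).
pose A : set T := [set f | forall p, box p (f p)] `&`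
  [set f | forall j, \sum_t sched f j t = 1].
have proj_cont j t : continuous (fun f : T => sched f j t).
  exact: (@proj_continuous _ (fun _ : idx => R) (j, t)).
have AP (z : schedule I) : (forall j t, 0 <= z j t) ->
    (forall j, \sum_t z j t = 1) -> supported z ->
    A ((fun p => z p.1 p.2) : T).
  move=> zp z1 zs; split=> //= -[j t]; rewrite /box/=.
  case: eqP => [/zs//|_]; rewrite /= in_itv/= zp/= -(z1 j).
  by rewrite (bigD1 t)//= lerDl sumr_ge0.
have A0 : A !=set0 by eexists; apply: (AP z0).
(* A closed subset of a product of compact boxes: the row sums are continuous. *)
have Ac : compact A.
  apply: (@subclosed_compact _ _ [set f : T | forall p, box p (f p)]).
  - rewrite /A; apply: closedI.
      rewrite (_ : [set f : T | _] = \bigcap_p ((fun f : T => f p) @^-1` box p)).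
        apply: closed_bigI => p _; apply: closed_comp.
          move=> f _; exact: (@proj_continuous _ (fun _ : idx => R) p).
        by rewrite /box; case: ifP => _; [exact: closed_eq|exact: itv_closed].
      by apply/seteqP; split => f /= h p; [move=> _; exact: h|exact: h].
    rewrite (_ : [set f : T | _] =
        \bigcap_j ((fun f : T => \sum_t sched f j t) @^-1` [set 1])).
      apply: closed_bigI => j _; apply: closed_comp; last exact: closed_eq.
      by move=> f _; apply: continuous_sumr.
    by apply/seteqP; split => f /= h j; [move=> _; exact: h|exact: h].
  - apply: (@tychonoff _ (fun _ : idx => R)) => p; rewrite /box; case: ifP => _.
      exact: compact_set1.
    exact: segment_compact.
  - by move=> f [].
have Aprop f : A f -> [/\ forall j t, 0 <= sched f j t,
    forall j, \sum_t sched f j t = 1 & supported (sched f)].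
  move=> [fb f1]; split => // j t; have := fb (j, t); rewrite /box/=.
    by case: ifP => _ /=; [move=> e; rewrite /sched e|rewrite in_itv => /andP[]].
  by move=> + jt; rewrite jt eqxx.
(* x `^ alpha is 1 for x < 0; the norm makes the cost continuous on all of T. *)
pose cost (f : T) : R :=
  beta I * (\sum_t `| slot_load (sched f) t | `^ alpha) + finite_scost (sched f).
have costE f : A f -> cost f =
    beta I * energy alpha (sched f) + finite_scost (sched f).
  move=> /Aprop[f0 _ _]; congr (_ * _ + _); apply: eq_bigr => t _.
  by rewrite ger0_norm// slot_load_ge0.
have cost_cont : continuous cost.
  have load_cont t : continuous (fun f : T => slot_load (sched f) t).
    apply: continuous_sumr => j f.
    exact: (cvgM (cvg_cst (work j)) (proj_cont j t f)).
  have scost_cont : continuous (fun f : T => finite_scost (sched f)).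
    apply: continuous_sumr => j; apply: continuous_sumr => t f.
    exact: (cvgM (cvg_cst (fine (scost j t))) (proj_cont j t f)).
  have energy_cont :
      continuous (fun f : T => \sum_t `|slot_load (sched f) t| `^ alpha).
    apply: continuous_sumr => t f.
    exact: (continuous_comp (load_cont t f)
      (@continuous_powR_norm _ _ al1 (slot_load (sched f) t))).
  move=> f.
  exact: (cvgD (cvgM (cvg_cst (beta I)) (energy_cont f)) (scost_cont f)).
have [c /set_mem cA cmin] :=
  compact_EVT_min A0 Ac (continuous_subspaceT cost_cont).
have [c0 c1 cs] := Aprop c cA.
exists (sched c); split=> //; split; first by split => // j; rewrite c1.
move=> z zf; have [zp z1] := zf.
(* An unsupported competitor costs [+oo]; a supported one is normalized row by row to land in
   [A]. *)
have [zs|zns] := pselect (supported z); last first.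
  by rewrite (total_cost_unsupported _ zp zns) leey.
rewrite !total_cost_supported// lee_fin -costE//.
have s0 j : 0 < \sum_u z j u by exact: lt_le_trans ltr01 (z1 j).
pose y : schedule I := fun j t => z j t / \sum_u z j u.
have yz j t : 0 <= y j t <= z j t.
  by rewrite divr_ge0 ?(ltW (s0 j))//= ler_pdivrMr// ler_peMr.
apply: le_trans (finite_cost_le al1 yz).
have Ay : A ((fun p => y p.1 p.2) : T).
  apply: AP => [j t|j|j t jt].
  - by case/andP: (yz j t).
  - by rewrite -mulr_suml divff// gt_eqF.
  - by rewrite /y zs// mul0r.
by have := cmin _ (mem_set Ay); rewrite [leRHS]costE.
Qed.

Theorem mainTheorem4 (R : realType) (alpha : R) (halpha : 1 < alpha) :
  exists K : R, forall (I : instance R) (zgreedy : schedule I),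
    greedy_schedule alpha zgreedy ->
    exists zopt : schedule I,
      optimal alpha zopt /\
      (total_cost alpha zgreedy <= K%:E * total_cost alpha zopt)%E.
Proof.
exists (alpha `^ alpha) => I zg gr; have zgs := greedy_supported gr.
have [z [zopt zs]] : exists z : schedule I, optimal alpha z /\ supported z.
  (* The greedy schedule itself shows that the compact set is nonempty. *)
  by apply: (optimal_exists halpha (z0 := zg)) => // j; case: (gr j).
exists z; split=> //; rewrite !total_cost_supported// -EFinM lee_fin.
exact: greedy_competitive (proj1 zopt) zs.
Qed.
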